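(* Let $G\subset G'$ be graded algebras without zero divisors, graded by ordered abelian semigroups, and let $x$ be a homogeneous element of $G'$. Assume that $x$ satisfies a homogeneous integral relation $x^n+a_1x^{n-1}+\dots+a_n=0$ with $a_j\in G^*$, and no algebraic relation over $G^*$ of degree smaller than $n$. Let $G[x]$ be the graded subalgebra of $G'$ generated by $x$ over $G$. Then every element of $(G[x])^*$ can be written uniquely as a polynomial in $x$ with coefficients in $G^*$, of degree strictly less than $n$.
   Context: For a graded algebra $G$ without zero divisors, its saturation is the graded algebra $G^*=\{g/h: g,h\in G,\ h\text{ homogeneous},\ h\neq0\}$ (inside the field of fractions). A homogeneous relation means that all $a_j$ are homogeneous and all nonzero terms $a_jx^{n-j}$ (with $a_0=1$) have the same degree. *)

(* Defs.v *)
(* MathComp, with classical sets from MathComp-Analysis. *)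
From HB Require Import structures.
From mathcomp Require Import all_boot all_algebra.
From mathcomp Require Import classical_sets cardinality fsbigop.

Set Implicit Arguments.
Unset Strict Implicit.
Unset Printing Implicit Defensive.

Import GRing.Theory.

Local Open Scope classical_set_scope.
Local Open Scope ring_scope.

(* The order is total, as is usual for valuations, and compatible with addition
   in the strict sense; hence the semigroup is cancellative and embeds in an
   ordered abelian group. No neutral element is required. *)
Record ordered_semigroup (Gam : addSemigroupType) (le : rel Gam) : Prop :=
  OrderedSemigroup {
  osg_refl : reflexive le;
  osg_anti : antisymmetric le;
  osg_trans : transitive le;
  osg_total : total le;
  osg_leD2r : forall z : Gam, {mono +%R^~ z : g h / le g h}
}.

(* The commutative k-algebras without zero divisors. *)
#[short(type="idomainAlgType")]
HB.structure Definition DomainAlgebra (k : comNzRingType) :=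
  {A of GRing.IntegralDomain A & GRing.Algebra k A}.

Section GradedAlgebras.
Variables (k : comNzRingType) (A : idomainAlgType k).

Section Grading.
Variable Gam : addSemigroupType.
Implicit Types (S : set A) (C : Gam -> set A).

(* The subset S is a subalgebra of A and is the direct sum of the submodules
   C g: each element of S has a unique finitely supported family of
   components. *)
Record graded_algebra S C : Prop := GradedAlgebra {
  graded_subalg : GRing.subalg_closed [in S];
  graded_submod : forall g, GRing.submod_closed [in C g];
  graded_sub : forall g, C g `<=` S;
  graded_mul : forall g h a b, C g a -> C h b -> C (g + h) (a * b);
  graded_decomp : forall a, S a ->
    exists! f : Gam -> A,
      [/\ forall g, C g (f g),
          finite_set [set g | f g != 0]
        & a = \sum_(g \in [set: Gam]) f g]
}.

Definition homogeneous C : set A := [set a | exists g, C g a].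

(* Here C is a grading of A. *)
Definition induced_comp S C : Gam -> set A := fun g => S `&` C g.

Definition graded_subalgebra C S := graded_algebra S (induced_comp S C).

(* G[x], as a graded subalgebra of A. *)
Definition adjoin C (G : set A) (x : A) : set A :=
  smallest (graded_subalgebra C) (G `|` [set x]).

(* The saturation of the algebra S graded by C. The field of fractions of S
   is identified with its image in that of A. *)
Definition saturation S C : set {fraction A} :=
  [set u | exists g h,
    [/\ S g, S h, homogeneous C h, h != 0 & u = tofrac g / tofrac h]].

(* The saturation is graded by the group of differences of Gam; the pair d
   stands for the difference d.1 - d.2. A quotient of homogeneous elements of
   degrees a and b has degree a - b. *)
Definition saturation_comp C (d : Gam * Gam) : set {fraction A} :=
  [set u | exists a b g h,
    [/\ C a g, C b h, h != 0, u = tofrac g / tofrac h & a + d.2 = d.1 + b]].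

Definition sat_homogeneous C : set {fraction A} :=
  [set u | exists d, saturation_comp C d u].

End Grading.

(* The relation x ^ n + a_1 x ^ (n - 1) + ... + a_n = 0, with a_0 = 1 and with
   coefficients in the saturation of the algebra G graded by C, holds and is
   homogeneous for the degrees of the ambient grading C'. *)
Record homogeneous_integral_relation
    (Gam Gam' : addSemigroupType)
    (G : set A) (C : Gam -> set A) (C' : Gam' -> set A)
    (x : {fraction A}) (n : nat) (a : nat -> {fraction A}) : Prop :=
  HomogeneousIntegralRelation {
  hir_coef : forall j, (j <= n)%N -> saturation G C (a j);
  hir_monic : a 0%N = 1;
  hir_rel : \sum_(j < n.+1) a j * x ^+ (n - j) = 0;
  hir_homog : forall j, (j <= n)%N -> sat_homogeneous C (a j);
  hir_degree : exists e : Gam' * Gam', forall j, (j <= n)%N ->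
    a j * x ^+ (n - j) != 0 -> saturation_comp C' e (a j * x ^+ (n - j))
}.

End GradedAlgebras.

(* Main.v *)
(* Nonzero homogeneous elements of G are units of G^*, so Euclidean division
   applies to polynomials that are homogeneous once x is given its degree in G',
   and its remainders are again homogeneous. Let f be the relation and h = p(x)
   a nonzero homogeneous element of G[x], with p homogeneous and of degree less
   than n. If f = s p + r then r is nonzero, since otherwise s(x) = 0 with s of
   degree less than n. By induction on the degree r(x) = - s(x) p(x) is
   invertible in G^*[x], hence so is h, and (G[x])^* = G^*[x]. Denominators are
   cleared throughout, so that the division takes place in G[X]. *)
From HB Require Import structures.
Require Import Defs.
From mathcomp Require Import all_boot all_algebra.
From mathcomp Require Import boolp classical_sets cardinality fsbigop.
From mathcomp Require Import ring zify.

Set Implicit Arguments.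
Unset Strict Implicit.
Unset Printing Implicit Defensive.

Import GRing.Theory.
Local Open Scope classical_set_scope.
Local Open Scope ring_scope.

Definition subring_pred (R : nzRingType) (S : {pred R})
    (h : GRing.subring_closed S) : subringClosed R :=
  HB.pack S (GRing.isSubringClosed.Build R S h).

(** * Graded algebras: homogeneous elements and uniqueness of components *)

Section Grading.
Variables (k : comNzRingType) (A : idomainAlgType k) (Gam : addSemigroupType).
Variables (S : set A) (C : Gam -> set A) (gradS : graded_algebra S C).

Definition decomposes (a : A) (f : Gam -> A) :=
  [/\ forall g, C g (f g), finite_set [set g | f g != 0]
    & a = \sum_(g \in [set: Gam]) f g].

Lemma graded_subring : GRing.subring_closed [in S].
Proof. exact: GRing.subalg_closedBM (graded_subalg gradS). Qed.

Lemma graded_subringP : [/\ S 1, (forall a b, S a -> S b -> S (a - b))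
  & forall a b, S a -> S b -> S (a * b)].
Proof.
have [S1 SB SM] := graded_subring; split=> [|a b|a b].
- by rewrite in_setE in S1.
- by have := SB a b; rewrite !in_setE.
- by have := SM a b; rewrite !in_setE.
Qed.

Lemma graded0 g : C g 0.
Proof. by have [/[!in_setE]] := graded_submod gradS g. Qed.

Lemma gradedP g (t : k) a b : C g a -> C g b -> C g (t *: a + b).
Proof.
move=> Ca Cb; have [_ Clin] := graded_submod gradS g.
by have := Clin t a b; rewrite !in_setE; apply.
Qed.

Lemma gradedD g a b : C g a -> C g b -> C g (a + b).
Proof. by move=> Ca Cb; rewrite -[a]scale1r; apply: gradedP. Qed.

Lemma gradedN g a : C g a -> C g (- a).
Proof.
by move=> Ca; rewrite -[- a]addr0 -scaleN1r; apply: gradedP => //; apply: graded0.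
Qed.

Lemma homogeneous_sub a : homogeneous C a -> S a.
Proof. by move=> [g /(graded_sub gradS)]. Qed.

Lemma homogeneousM a b :
  homogeneous C a -> homogeneous C b -> homogeneous C (a * b).
Proof. by move=> [g Ca] [h Cb]; exists (g + h); apply: (graded_mul gradS). Qed.

Lemma homogeneousX a b i :
  homogeneous C a -> homogeneous C b -> homogeneous C (a * b ^+ i).
Proof.
move=> Ca Cb; elim: i => [|i IH]; first by rewrite mulr1.
by rewrite exprSr mulrA; apply: homogeneousM.
Qed.

Lemma graded_ind (P : A -> Prop) : P 0 -> (forall a b, P a -> P b -> P (a + b)) ->
  (forall a, homogeneous C a -> P a) -> forall a, S a -> P a.
Proof.
move=> P0 PD Ph a /(graded_decomp gradS)[f [[Cf _ ->] _]].
by apply: big_ind => // g _; apply: Ph; exists g.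
Qed.

(** The grading does not assume 1 homogeneous; but 1 is a sum of homogeneous elements, and these
    cannot all vanish. *)
Lemma homogeneous_neq0 : exists2 c : A, homogeneous C c & c != 0.
Proof.
apply: contrapT => no.
have: (1 : A) = 0.
  apply: (graded_ind (P := fun a => a = 0)) => //.
  - by move=> a b -> ->; rewrite addr0.
  - by move=> a Ca; apply: contrapT => /eqP a0; apply: no; exists a.
  - by have [/[!in_setE]] := graded_subalg gradS.
by apply/eqP; rewrite oner_eq0.
Qed.

Lemma decomposes_inj a f f' : S a -> decomposes a f -> decomposes a f' -> f = f'.
Proof.
by move=> /(graded_decomp gradS)[f0 [_ uf]] /uf <- /uf <-.
Qed.

Lemma decomposesD a b f f' :
  decomposes a f -> decomposes b f' -> decomposes (a + b) (fun g => f g + f' g).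
Proof.
move=> [Cf ff ->] [Cf' ff' ->].
have fU : finite_set ([set g | f g != 0] `|` [set g | f' g != 0]).
  by rewrite finite_setU.
(* All three families vanish off the union of the two supports, so their sums are compared over that
   finite set. *)
have sup (h : Gam -> A) : (forall g, h g != 0 -> f g != 0 \/ f' g != 0) ->
    \sum_(g \in [set: Gam]) h g =
    \sum_(g \in [set g | f g != 0] `|` [set g | f' g != 0]) h g.
  move=> hsub; apply/esym/fsbig_widen => // g [_ /= /not_orP[n1 n2]].
  by apply: contrapT => /eqP /hsub; tauto.
have subU g : f g + f' g != 0 -> f g != 0 \/ f' g != 0.
  have [->|] := eqVneq (f g) 0; last by left.
  by rewrite add0r; right.
split=> [g||].
- by apply: gradedD.
- by apply: sub_finite_set fU => g /subU.
- by rewrite !sup ?fsbig_split//; [by right|by left].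
Qed.

Lemma decomposes_homogeneous g a :
  C g a -> decomposes a (fun h => if h == g then a else 0).
Proof.
move=> Ca; split=> [h||].
- by case: eqP => [->//|_]; apply: graded0.
- apply: sub_finite_set (finite_set1 g) => h /=.
  by have [//|_] := eqVneq h g; rewrite eqxx.
- rewrite -(fsbig_widen [set g]) ?fsbig_set1 ?eqxx//.
  by move=> h [_ /= /eqP /negbTE ->].
Qed.

(** Placing [a] in degree [g] or in degree [h] gives two decompositions of [a]; by uniqueness they
    agree at [h], where the second is nonzero. *)
Lemma degree_inj g h a : a != 0 -> C g a -> C h a -> g = h.
Proof.
move=> a0 Cg Ch.
have /(congr1 (@^~ h)) := decomposes_inj (graded_sub gradS Cg)
  (decomposes_homogeneous Cg) (decomposes_homogeneous Ch).
by rewrite eqxx; case: eqP => // _ /esym/eqP; rewrite (negbTE a0).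
Qed.

End Grading.

(** * Homogeneous polynomials over [G] and their division *)

Section HomogeneousPolynomials.
Variables (k : comNzRingType) (A : idomainAlgType k).
Variables (Gam Gam' : addSemigroupType) (phi : Gam -> Gam').
Hypothesis phi_inj : injective phi.
Hypothesis addI' : forall z : Gam', injective (+%R^~ z).
Variables (C' : Gam' -> set A) (gradA : graded_algebra [set: A] C').
Variables (G : set A) (C : Gam -> set A) (gradG : graded_algebra G C).
Hypothesis subC : forall g, C g `<=` C' (phi g).
Variables (x : A) (x_hom : homogeneous C' x).

Let Gs : subringClosed A := subring_pred (graded_subring gradG).

Lemma homogeneous_subC a : homogeneous C a -> homogeneous C' a.
Proof. by move=> [g /subC]; exists (phi g). Qed.

(* The polynomial p is homogeneous of degree D - deg z, where x has its degree
   in A. The multiplier z stands in for the missing differences of degrees, and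
   the last condition forces p to be constant when x = 0. *)
Definition homogeneous_poly (z : A) (D : Gam') (p : {poly A}) :=
  forall i, p`_i != 0 ->
    [/\ homogeneous C p`_i, C' D (p`_i * x ^+ i * z) & x ^+ i * z != 0].

Definition is_homogeneous_poly p := exists z D, homogeneous_poly z D p.

Lemma homogeneous_poly_over z D p : homogeneous_poly z D p -> p \is a polyOver Gs.
Proof.
move=> hp; apply/polyOverP => i; have [->|/hp[Cpi _ _]] := eqVneq p`_i 0.
  exact: rpred0.
by rewrite in_setE; apply: (homogeneous_sub gradG).
Qed.

Lemma homogeneous_poly0 z D : homogeneous_poly z D 0.
Proof. by move=> i; rewrite coef0 eqxx. Qed.

Lemma homogeneous_polyN z D p : homogeneous_poly z D p -> homogeneous_poly z D (- p).
Proof.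
move=> hp i; rewrite coefN oppr_eq0 => /hp[[g Cg] C'D xz].
split=> //; first by exists g; apply: (gradedN gradG).
by rewrite !mulNr; apply: (gradedN gradA).
Qed.

Lemma homogeneous_polyD z D p q :
  homogeneous_poly z D p -> homogeneous_poly z D q -> homogeneous_poly z D (p + q).
Proof.
move=> hp hq i; rewrite coefD.
have [->|p0] := eqVneq p`_i 0; first by rewrite add0r; apply: hq.
have [->|q0] := eqVneq q`_i 0; first by rewrite addr0; apply: hp.
have [[g Cp] Dp xz] := hp i p0; have [[h Cq] Dq _] := hq i q0.
move=> _; split=> //; last by rewrite !mulrDl; apply: (gradedD gradA).
exists g; apply: (gradedD gradG) => //.
(* The nonzero product of [p]_i[,]q[_i] and [x ^+ i * z] has degree [phi g + D] when the last factor
   is grouped with [q]_i[, and]phi h + D[when it is grouped with]p[_i]. *)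
suff -> : g = h by [].
apply: phi_inj; apply: (@addI' D); apply: (degree_inj gradA
    (a := p`_i * q`_i * (x ^+ i * z))).
- by apply: mulf_neq0 => //; apply: mulf_neq0.
- rewrite -mulrA [q`_i * _]mulrA.
  by apply: (graded_mul gradA) => //; apply: subC.
- rewrite [p`_i * _]mulrC -mulrA [p`_i * _]mulrA.
  by apply: (graded_mul gradA) => //; apply: subC.
Qed.

Lemma homogeneous_polyZ z D g c p : c != 0 -> C g c ->
  homogeneous_poly z D p -> homogeneous_poly z (phi g + D) (c *: p).
Proof.
move=> c0 Cc hp i; rewrite coefZ mulf_eq0 (negbTE c0) /= => /hp[Cp Dp xz].
split=> //; first by apply: (homogeneousM gradG) => //; exists g.
by rewrite -!(mulrA c); apply: (graded_mul gradA) => //; apply: subC.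
Qed.

(* Both terms of the cancellation step below become homogeneous of degree
   D_f + D_p after multiplication by x ^ M z_f z_p, where M is the degree of p. *)
Lemma homogeneous_poly_cancel (f p : {poly A}) m :
  size f = (size p + m)%N -> p != 0 -> f != 0 ->
  is_homogeneous_poly f -> is_homogeneous_poly p ->
  is_homogeneous_poly (lead_coef p *: f - (lead_coef f *: 'X^m) * p).
Proof.
move=> sfp p0 f0 [zf [Df hf]] [zp [Dp hp]].
have lp0 : lead_coef p != 0 by rewrite lead_coef_eq0.
have lf0 : lead_coef f != 0 by rewrite lead_coef_eq0.
have [Clp Dlp xzp] := hp _ lp0; have [Clf Dlf xzf] := hf _ lf0.
exists (x ^+ (size p).-1 * zf * zp), (Df + Dp).
apply: homogeneous_polyD; last apply: homogeneous_polyN.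
- move=> i; rewrite coefZ mulf_eq0 (negbTE lp0) /= => fi.
  have [Cf D xz] := hf i fi.
  split; first exact: (homogeneousM gradG).
  + have -> : lead_coef p * f`_i * x ^+ i * (x ^+ (size p).-1 * zf * zp) =
      (f`_i * x ^+ i * zf) * (lead_coef p * x ^+ (size p).-1 * zp) by ring.
    exact: (graded_mul gradA).
  + have -> : x ^+ i * (x ^+ (size p).-1 * zf * zp) =
      (x ^+ i * zf) * (x ^+ (size p).-1 * zp) by ring.
    by rewrite mulf_neq0.
- move=> i; rewrite -scalerAl coefZ coefXnM.
  case: ltnP => [|mi]; first by rewrite mulr0 eqxx.
  rewrite mulf_eq0 (negbTE lf0) /= => pi.
  have [Cp D xz] := hp _ pi.
  have sf : ((size f).-1 = (size p).-1 + m)%N.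
    by rewrite sfp; move: p0; rewrite -size_poly_gt0; case: (size p).
  have xi : x ^+ i = x ^+ (i - m) * x ^+ m by rewrite -exprD subnK.
  split; first exact: (homogeneousM gradG).
  + have -> : lead_coef f * p`_(i - m) * x ^+ i * (x ^+ (size p).-1 * zf * zp) =
      (lead_coef f * x ^+ (size f).-1 * zf) * (p`_(i - m) * x ^+ (i - m) * zp).
      by rewrite xi sf exprD; ring.
    exact: (graded_mul gradA).
  + have -> : x ^+ i * (x ^+ (size p).-1 * zf * zp) =
      (x ^+ (i - m) * zp) * (x ^+ (size f).-1 * zf) by rewrite xi sf exprD; ring.
    by rewrite mulf_neq0.
Qed.

(** Each step cancels leading terms by cross-multiplying with leading coefficients. The multiplier
    [c] is thus a power of the leading coefficient of [p], homogeneous and nonzero. *)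
Lemma homogeneous_pseudo_division f p : p != 0 ->
  is_homogeneous_poly f -> is_homogeneous_poly p ->
  exists c s r, [/\ homogeneous C c /\ c != 0, s \is a polyOver Gs,
    is_homogeneous_poly r, (size r < size p)%N & c *: f = s * p + r].
Proof.
move=> p0 + hp.
have lp0 : lead_coef p != 0 by rewrite lead_coef_eq0.
have [zp [Dp hp']] := hp; have [Clp _ _] := hp' _ lp0.
have [N] := ubnP (size f); elim: N f => // N IH f sfN hf.
have [sfp|spf] := ltnP (size f) (size p).
  (* The multiplier must be homogeneous, which is not assumed of 1; the leading coefficient of [p]
     serves instead. *)
  exists (lead_coef p), 0, (lead_coef p *: f); split=> //.
  - exact: rpred0.
  - by have [z [D hf']] := hf; have [g Cg] := Clp; exists z, (phi g + D);
      apply: homogeneous_polyZ.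
  - by rewrite size_scale.
  - by rewrite mul0r add0r.
have f0 : f != 0 by rewrite -size_poly_gt0 (leq_trans _ spf) // size_poly_gt0.
have lf0 : lead_coef f != 0 by rewrite lead_coef_eq0.
pose m := (size f - size p)%N.
have sfm : size f = (size p + m)%N by rewrite subnKC.
have hf1 := homogeneous_poly_cancel sfm p0 f0 hf hp.
set f1 := (X in is_homogeneous_poly X) in hf1.
have sp : size p = (size p).-1.+1 by rewrite -polySpred.
have sf : size f = ((size p).-1 + m).+1 by rewrite sfm {1}sp.
have sf1 : (size f1 < size f)%N.
  rewrite sf ltnS; apply/leq_sizeP => j; rewrite leq_eqVlt => /orP[/eqP <-|].
    rewrite coefB coefZ -scalerAl coefZ coefXnM ltnNge leq_addl /= addnK.
    have -> : f`_((size p).-1 + m) = lead_coef f by rewrite lead_coefE sf.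
    by rewrite -lead_coefE mulrC subrr.
  move=> lj; rewrite coefB coefZ -scalerAl coefZ coefXnM.
  rewrite nth_default ?sf // ltnNge (leq_trans (leq_addl _ _) (ltnW lj)) /=.
  by rewrite nth_default ?mulr0 ?subrr // sp ltn_subRL addnC.
have [c [s [r [[Cc c0] sG hr sr e]]]] := IH f1 (leq_trans sf1 sfN) hf1.
have [zf [Df hf']] := hf; have [Clf _ _] := hf' _ lf0.
exists (c * lead_coef p), (s + c *: (lead_coef f *: 'X^m)), r; split=> //.
- by split; [apply: (homogeneousM gradG)|rewrite mulf_neq0].
- rewrite rpredD // !polyOverZ ?rpredX ?polyOverX //.
    by rewrite in_setE; apply: (homogeneous_sub gradG).
  by rewrite in_setE; apply: (homogeneous_sub gradG).
- rewrite mulrDl addrAC -e /f1 scalerBr scalerA -!scalerAl.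
  by rewrite subrK.
Qed.

(** At the leading exponent, which is positive, the condition [x ^+ i * z != 0] excludes [x = 0].
    This gives access to [hom_f] below. *)
Lemma root_neq0 p : is_homogeneous_poly p -> (1 < size p)%N -> x != 0.
Proof.
move=> [z [D hp]] sp; have p0 : p`_(size p).-1 != 0.
  by rewrite -lead_coefE lead_coef_eq0 -size_poly_gt0 ltnW.
have [_ _] := hp _ p0; apply: contra => /eqP ->.
by rewrite expr0n; case: (size p) sp => [|[|m]] //= _; rewrite mul0r.
Qed.

(** * Inverting values of homogeneous polynomials up to a homogeneous constant *)

Section Inverse.
Variables (f : {poly A}) (n : nat).
Hypotheses (size_f : size f = n.+1) (root_f : f.[x] = 0).
Hypothesis hom_f : x != 0 -> is_homogeneous_poly f.
Hypothesis min_f : forall p : {poly A},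
  p \is a polyOver Gs -> p != 0 -> (size p <= n)%N -> p.[x] != 0.

(* Euclid's algorithm for f and p. No remainder vanishes: otherwise s.[x] = 0
   with s of degree at most n - 1. *)
Lemma homogeneous_inverse_small p : is_homogeneous_poly p -> p != 0 ->
  (size p <= n)%N -> exists q c, [/\ q \is a polyOver Gs, homogeneous C c,
    c != 0 & q.[x] * p.[x] = c].
Proof.
have [N] := ubnP (size p); elim: N p => // N IH p spN hp p0 spn.
have pG : p \is a polyOver Gs by have [z [D /homogeneous_poly_over]] := hp.
have [sp1|sp1] := leqP (size p) 1.
  have /size1_polyC pE := sp1.
  have c0 : p`_0 != 0 by move: p0; rewrite {1}pE polyC_eq0.
  have [z [D hp']] := hp; have [Cc _ _] := hp' _ c0.
  exists 1, p`_0; split=> //; first exact: rpred1.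
  by rewrite {1}pE !hornerE.
have hf := hom_f (root_neq0 hp sp1).
have [c [s [r [[Cc c0] sG hr sr e]]]] := homogeneous_pseudo_division p0 hf hp.
have ex : s.[x] * p.[x] = - r.[x].
  by apply/eqP; rewrite -addr_eq0 -hornerM -hornerD -e hornerZ root_f mulr0.
have r0 : r != 0.
  apply/eqP => r0; move: e ex; rewrite r0 addr0 horner0 oppr0 => e /eqP.
  have s0 : s != 0.
    apply/eqP => s0; move/eqP: e; rewrite s0 mul0r.
    by rewrite -size_poly_eq0 size_scale // size_f.
  rewrite mulf_eq0 (negbTE (min_f pG p0 spn)) orbF; apply/negP/min_f => //.
  (* The sizes of [s] and [p] add up to [n + 2], and [p] has size at least 2. *)
  have := congr1 (fun t : {poly A} => size t) e.
  rewrite /= size_scale // size_f size_mul // => /eqP.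
  case: (size p) sp1 => [|[|m]] // _.
  by rewrite !addnS /= eqSS => /eqP ->; rewrite leq_addr.
have [q [d [qG Cd d0 qd]]] := IH r (leq_trans sr spN) hr r0
  (leq_trans (ltnW sr) spn).
have [z [D /homogeneous_poly_over rG]] := hr.
exists (- (q * s)), d; split=> //; first by rewrite rpredN rpredM.
by rewrite hornerN hornerM mulNr -mulrA ex mulrN opprK.
Qed.

(** Dividing [p] by [f] first gives [c * p.[x] = r.[x]] with [r] homogeneous and of size at most
    [n], which reduces to the previous case. *)
Lemma homogeneous_inverse p : is_homogeneous_poly p -> p.[x] != 0 ->
  exists q c, [/\ q \is a polyOver Gs, homogeneous C c,
    c != 0 & q.[x] * p.[x] = c].
Proof.
move=> hp px; have p0 : p != 0 by apply: contraNneq px => ->; rewrite horner0.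
have [spn|spn] := leqP (size p) n; first exact: homogeneous_inverse_small.
(* For [n = 0] the polynomial [f] would be a nonzero constant with a root. For [n > 0] the size of
   [p] exceeds 1, so that [x] is nonzero. *)
have [n0|n0] := posnP n.
  move: root_f => /eqP; have /size_poly1P[c c0 ->] : size f == 1%N.
    by rewrite size_f n0.
  by rewrite hornerC (negbTE c0).
have hf := hom_f (root_neq0 hp (leq_ltn_trans n0 spn)).
have f0 : f != 0 by rewrite -size_poly_gt0 size_f.
have [c [s [r [[Cc c0] sG hr sr e]]]] := homogeneous_pseudo_division f0 hp hf.
have ex : c * p.[x] = r.[x].
  by rewrite -hornerZ e hornerD hornerM root_f mulr0 add0r.
have r0 : r != 0.
  apply: contraNneq px => r0; move/eqP: ex.
  by rewrite r0 horner0 mulf_eq0 (negbTE c0).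
rewrite size_f in sr.
have [q [d [qG Cd d0 qd]]] := homogeneous_inverse_small hr r0 sr.
exists (c *: q), d; split=> //; last by rewrite hornerZ mulrAC ex mulrC.
by rewrite polyOverZ // in_setE; apply: (homogeneous_sub gradG).
Qed.

End Inverse.

(** * Elements of [G[x]] and their components as values of polynomials *)

Lemma decomposes_horner p f : p \is a polyOver Gs -> decomposes C' p.[x] f ->
  forall D, exists2 q, homogeneous_poly 1 D q & f D = q.[x].
Proof.
(* [K b] asks for one decomposition of [b] into values of homogeneous polynomials. It is additive
   and holds for monomials with homogeneous coefficient; uniqueness of components transfers it to
   the given [f]. *)
pose K b := exists2 f, decomposes C' b f &
  forall D, exists2 q, homogeneous_poly 1 D q & f D = q.[x].
have K0 : K 0.
  have [g _] := x_hom; exists (fun h => if h == g then 0 else 0).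
    by apply: (decomposes_homogeneous gradA); apply: (graded0 gradA).
  by move=> D; exists 0; [apply: homogeneous_poly0|rewrite horner0; case: eqP].
have KD a b : K a -> K b -> K (a + b).
  move=> [fa da ha] [fb db hb]; exists (fun g => fa g + fb g).
    exact: (decomposesD gradA).
  move=> D; have [p1 h1 ->] := ha D; have [p2 h2 ->] := hb D.
  by exists (p1 + p2); rewrite ?hornerD //; apply: homogeneous_polyD.
have Kmon c i : G c -> K (c * x ^+ i).
  move: c; apply: (graded_ind gradG (P := fun c => K (c * x ^+ i))).
  - by rewrite mul0r.
  - by move=> a b Ka Kb; rewrite mulrDl; apply: KD.
  (* A vanishing monomial is represented by the zero polynomial, since [homogeneous_poly] requires
     [x ^+ i] to be nonzero. *)
  - move=> c Cc; have [->//|cx0] := eqVneq (c * x ^+ i) 0.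
    have [D0 CD0] := homogeneousX gradA i (homogeneous_subC Cc) x_hom.
    exists (fun h => if h == D0 then c * x ^+ i else 0).
      exact: (decomposes_homogeneous gradA).
    move=> D; have [->|_] := eqVneq D D0; last first.
      by exists 0; [apply: homogeneous_poly0|rewrite horner0].
    exists (c *: 'X^i); last by rewrite hornerZ hornerXn.
    move=> j; rewrite coefZ coefXn; have [->|] := eqVneq j i; last first.
      by rewrite mulr0 eqxx.
    move=> _; rewrite !mulr1; split=> //.
    by apply: contra cx0 => /eqP ->; rewrite mulr0.
move=> /polyOverP pG df.
have [f' df' hf'] : K p.[x].
  rewrite horner_coef; apply: big_ind => // i _; apply: Kmon.
  by have := pG i; rewrite in_setE.
by rewrite (decomposes_inj gradA _ df df').
Qed.

(** The values at [x] of polynomials over [G] form a graded subalgebra containing [G] and [x].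
    Stability under taking components is [decomposes_horner]. *)
Lemma adjoin_horner a :
  adjoin C' G x a -> exists2 p, p \is a polyOver Gs & a = p.[x].
Proof.
pose B := [set b | exists2 p, p \is a polyOver Gs & b = p.[x]].
suff gB : graded_subalgebra C' B.
  move/(_ B); apply; split=> // b [Gb|->].
    exists b%:P; last by rewrite hornerC.
    by rewrite polyOverC in_setE.
  by exists 'X; rewrite ?hornerX ?polyOverX.
have BP (t : k) b c : B b -> B c -> B (t *: b + c).
  move=> [p pG ->] [q qG ->]; exists (t%:A%:P * p + q).
    rewrite rpredD ?rpredM // polyOverC in_setE -[t%:A]addr0.
    have [/[!in_setE] G1 Glin _] := graded_subalg gradG.
    by apply/set_mem/Glin; rewrite ?in_setE // -[G 0]in_setE (rpred0 Gs).
  by rewrite !hornerE mulr_algl.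
have B0 : B 0 by exists 0; rewrite ?rpred0 ?horner0.
have BM b c : B b -> B c -> B (b * c).
  by move=> [p pG ->] [q qG ->]; exists (p * q); rewrite ?rpredM ?hornerM.
split=> [|g|g b []|g h b c [Bb Cb] [Bc Cc]|b Bb] //.
- split=> [|t b c|b c]; rewrite !in_setE; [|exact: BP|exact: BM].
  by exists 1; rewrite ?rpred1 ?hornerC.
- split=> [|t b c]; rewrite !in_setE; first by split=> //; apply: (graded0 gradA).
  by move=> [Bb Cb] [Bc Cc]; split; [apply: BP|apply: (gradedP gradA)].
- by split; [apply: BM|apply: (graded_mul gradA)].
- have [f [df uf]] := graded_decomp gradA (I : [set: A] b).
  exists f; split=> [|f' [Cf ff bf]]; last by apply: uf; split=> // g; case: (Cf g).
  have [Cf ff bf] := df; split=> // g; split=> //.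
  move: Bb df => [p pG ->] /(decomposes_horner pG) /(_ g) [q hq ->].
  by exists q => //; apply: homogeneous_poly_over hq.
Qed.

Lemma homogeneous_adjoin h :
  homogeneous (induced_comp (adjoin C' G x) C') h ->
  exists2 p, is_homogeneous_poly p & h = p.[x].
Proof.
move=> [D [/adjoin_horner[p pG ->] CD]].
have [q hq e] := decomposes_horner pG (decomposes_homogeneous gradA CD) D.
by exists q; [exists 1, D|rewrite -e eqxx].
Qed.

End HomogeneousPolynomials.

(** Euclidean division by [f] stays over [S] because the leading coefficient of [f] is invertible in
    [S]; subtracting multiples of [f] does not change the value at the root [x]. *)
Lemma horner_reduce (F : fieldType) (S : subringClosed F) (f p : {poly F}) (x : F) :
  f != 0 -> f \is a polyOver S -> (lead_coef f)^-1 \in S -> root f x ->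
  p \is a polyOver S ->
  exists q, [/\ q \is a polyOver S, (size q < size f)%N & q.[x] = p.[x]].
Proof.
move=> f0 fS lfS /rootP fx; have [N] := ubnP (size p).
elim: N p => // N IH p spN pS.
have [spf|sfp] := ltnP (size p) (size f); first by exists p.
have lf0 : lead_coef f != 0 by rewrite lead_coef_eq0.
have sf0 : (0 < size f)%N by rewrite size_poly_gt0.
have sp0 : (0 < size p)%N by apply: leq_trans sfp.
pose m := (size p - size f)%N; pose c := lead_coef p / lead_coef f.
pose p1 := p - (c *: 'X^m) * f.
have [||q [qS sq qE]] := IH p1; last first.
- by exists q; split=> //; rewrite qE /p1 hornerD hornerN hornerM fx mulr0 subr0.
- rewrite rpredB // rpredM // polyOverZ ?rpredX ?polyOverX // rpredM //.
  by rewrite lead_coefE; apply: (polyOverP pS).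
- rewrite -ltnS; apply: leq_trans spN; rewrite ltnS.
  rewrite -(prednK sp0) ltnS; apply/leq_sizeP => j.
  have sm : (size f).-1 = ((size p).-1 - m)%N by rewrite /m; lia.
  rewrite leq_eqVlt => /orP[/eqP <-|lj]; rewrite coefB -scalerAl coefZ coefXnM.
    have -> : ((size p).-1 < m)%N = false by rewrite /m; lia.
    by rewrite -sm -!lead_coefE divfK // subrr.
  have -> : (j < m)%N = false by rewrite /m; lia.
  have pj : (size p <= j)%N by lia.
  have fj : (size f <= j - m)%N by rewrite /m; lia.
  by rewrite !nth_default // mulr0 subrr.
Qed.

(** * The saturation as a ring, and common denominators *)

Section Saturation.
Variables (k : comNzRingType) (A : idomainAlgType k) (Gam : addSemigroupType).
Variables (G : set A) (C : Gam -> set A) (gradG : graded_algebra G C).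

Let Gs : subringClosed A := subring_pred (graded_subring gradG).

Lemma saturation_div g h :
  G g -> homogeneous C h -> h != 0 -> saturation G C (tofrac g / tofrac h).
Proof.
by move=> Gg Ch h0; exists g, h; split=> //; apply: (homogeneous_sub gradG).
Qed.

Lemma saturation_tofrac g : G g -> saturation G C (tofrac g).
Proof.
move=> Gg; have [c Cc c0] := homogeneous_neq0 gradG.
(* Denominators must be homogeneous, so [g] is expanded by a nonzero homogeneous [c] rather than
   written over 1. *)
have -> : tofrac g = tofrac (g * c) / tofrac c :> {fraction A}.
  by rewrite tofracM mulfK // tofrac_eq0.
apply: saturation_div => //; have [_ _ GM] := graded_subringP gradG.
by apply: GM => //; apply: (homogeneous_sub gradG).
Qed.

Lemma saturation_subring : GRing.subring_closed [in saturation G C].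
Proof.
have [G1 GB GM] := graded_subringP gradG.
split=> [|u v|u v]; rewrite !in_setE.
- by rewrite -tofrac1; apply: saturation_tofrac.
- move=> [g [h [Gg Gh Ch h0 ->]]] [g' [h' [Gg' Gh' Ch' h0' ->]]].
  rewrite -mulNr addf_div ?tofrac_eq0 // -tofracN -!tofracM -tofracD.
  apply: saturation_div; rewrite ?mulf_neq0 //; last exact: (homogeneousM gradG).
  by rewrite mulNr; apply: GB; apply: GM.
- move=> [g [h [Gg Gh Ch h0 ->]]] [g' [h' [Gg' Gh' Ch' h0' ->]]].
  rewrite mulf_div -!tofracM.
  apply: saturation_div; rewrite ?mulf_neq0 //; last exact: (homogeneousM gradG).
  exact: GM.
Qed.

Lemma map_tofrac_over (p : {poly A}) : p \is a polyOver Gs ->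
  map_poly (@tofrac A) p \is a polyOver (subring_pred saturation_subring).
Proof.
move=> /polyOverP pG; apply/polyOverP => i; rewrite coef_map /= in_setE.
by apply: saturation_tofrac; have := pG i; rewrite in_setE.
Qed.

(** [H] is a product of homogeneous denominators. As the [a j] are homogeneous, their numerators are
    too, and so are the cleared coefficients [b j]. *)
Lemma common_denominator (a : nat -> {fraction A}) N :
  (forall j, (j < N)%N -> sat_homogeneous C (a j)) ->
  exists H b, [/\ homogeneous C H, H != 0 & forall j, (j < N)%N ->
    homogeneous C (b j) /\ tofrac H * a j = tofrac (b j)].
Proof.
elim: N => [|N IH] ha.
  by have [c Cc c0] := homogeneous_neq0 gradG; exists c, (fun=> 0).
have [j jN|H [b [CH H0 hb]]] := IH; first exact: ha (ltnW jN).
have [d [dg [dh [g [h [Cg Cdh h0 aN _]]]]]] := ha N (ltnSn N).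
have Ch : homogeneous C h by exists dh.
exists (H * h), (fun j => if j == N then H * g else b j * h); split.
- exact: (homogeneousM gradG).
- by rewrite mulf_neq0.
move=> j; rewrite ltnS leq_eqVlt => /orP[/eqP ->|jN].
  rewrite eqxx aN !tofracM; split.
    by apply: (homogeneousM gradG) => //; exists dg.
  by rewrite mulrA [_ * tofrac g]mulrAC mulfK // tofrac_eq0.
rewrite ltn_eqF //; have [Cb e] := hb j jN; split.
  exact: (homogeneousM gradG).
by rewrite !tofracM mulrAC e.
Qed.

End Saturation.

(** [f] is the relation multiplied by a common denominator [H], which becomes its leading
    coefficient. For [x = 0] and [n > 0] its leading term would violate [x ^+ i * z != 0], hence the
    premise [x != 0]. *)
Lemma relation_polynomial (k : comNzRingType) (A : idomainAlgType k)
    (Gam Gam' : addSemigroupType) (addI' : forall z : Gam', injective (+%R^~ z))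
    (phi : Gam -> Gam')
    (C' : Gam' -> set A) (gradA : graded_algebra [set: A] C')
    (G : set A) (C : Gam -> set A) (gradG : graded_algebra G C)
    (subC : forall g, C g `<=` C' (phi g))
    (x : A) (x_hom : homogeneous C' x) (n : nat) (a : nat -> {fraction A}) :
  homogeneous_integral_relation G C C' (tofrac x) n a ->
  exists f : {poly A}, [/\ size f = n.+1, f.[x] = 0,
    forall i, homogeneous C f`_i & x != 0 -> is_homogeneous_poly C' C x f].
Proof.
move=> [_ a0 rel ha [e he]].
have [H [b [CH H0 hb]]] := common_denominator (N := n.+1) gradG ha.
have CH' : homogeneous C' H by apply: homogeneous_subC subC _ CH.
have b0 : b 0%N = H.
  have [_ /eqP] := hb 0%N isT; by rewrite a0 mulr1 tofrac_eq => /eqP.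
exists (\poly_(i < n.+1) b (n - i)%N); split.
- by rewrite size_poly_eq //= subnn b0.
- apply/eqP; rewrite -tofrac_eq0 -(mulr0 (tofrac H)) -[X in _ * X]rel.
  rewrite horner_poly rmorph_sum mulr_sumr (reindex_inj rev_ord_inj) /=.
  apply/eqP; apply: eq_bigr => i _; have [_ e'] := hb i (ltn_ord i).
  by rewrite mulrA e' subSS subKn ?tofracM ?tofracXn // -ltnS.
- move=> i; rewrite coef_poly; case: ltnP => [_|_].
    by have [] := hb (n - i)%N (leq_subr i n).
  by have [g _] := CH; exists g; apply: (graded0 gradG).
move=> x0.
(* The degree of b_j x^(n-j) = H a_j x^(n-j) is deg H + e, for all j. *)
have deg j D : (j <= n)%N -> b j != 0 -> C' D (b j * x ^+ (n - j)) ->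
    forall E, C' E H -> D + e.2 = E + e.1.
  move=> jn bj CD E CE; have [_ ab] := hb j jn.
  have xj : tofrac x ^+ (n - j) != 0 by rewrite expf_neq0 // tofrac_eq0.
  have aj : a j != 0.
    by move: bj; rewrite -tofrac_eq0 -ab mulf_eq0 => /norP[].
  have [al [be [u [v [Cu Cv v0 uv deg]]]]] := he j jn (mulf_neq0 aj xj).
  (* Clearing denominators in [a j * x ^+ (n - j) = u / v] and comparing degrees gives
     [D + be = E + al]; with [al + e.2 = e.1 + be], cancelling [be] yields the claim. *)
  have tvHu : b j * x ^+ (n - j) * v = H * u.
    apply/eqP; rewrite -tofrac_eq !tofracM tofracXn -ab -(mulrA _ (a j)) uv.
    by rewrite -mulrA divfK ?tofrac_eq0.
  have tv0 : b j * x ^+ (n - j) * v != 0 by rewrite !mulf_neq0 ?expf_neq0.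
  have eDE : D + be = E + al.
    apply: (degree_inj gradA tv0); first exact: (graded_mul gradA).
    by rewrite tvHu; apply: (graded_mul gradA).
  by apply: (addI' be); rewrite /= Algebra.addrAC eDE -!Algebra.addrA deg.
have [E CE] := CH'.
(* The common degree [D0] is that of the leading term [H * x ^+ n]; any other nonzero term satisfies
   the same equation as [D0], and [e.2] cancels. *)
have [D0 CD0] := homogeneousX gradA n CH' x_hom.
have deg0 : D0 + e.2 = E + e.1.
  by apply: (deg 0%N); rewrite ?b0 ?subn0.
exists 1, D0 => i; rewrite coef_poly; case: ltnP => [|_]; last by rewrite eqxx.
rewrite ltnS => le_in bi; have [Cb _] := hb (n - i)%N (leq_subr i n).
rewrite !mulr1 expf_neq0 //; split=> //.
have [D CD] := homogeneousX gradA i (homogeneous_subC subC Cb) x_hom.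
suff -> : D0 = D by [].
apply: (addI' e.2) => /=; rewrite deg0; apply/esym/(deg (n - i)%N) => //.
- exact: leq_subr.
- by rewrite subKn.
Qed.

(** * Existence and uniqueness of the reduced polynomial *)

Theorem lemma2p6 (k : comNzRingType) (Gam Gam' : addSemigroupType)
    (le : rel Gam) (ordGam : ordered_semigroup le)
    (le' : rel Gam') (ordGam' : ordered_semigroup le')
    (phi : Gam -> Gam')
    (phiD : {morph phi : g h / g + h >-> g + h})
    (phi_le : {mono phi : g h / le g h >-> le' g h})
    (A : idomainAlgType k)
    (C' : Gam' -> set A) (gradA : graded_algebra [set: A] C')
    (G : set A) (C : Gam -> set A) (gradG : graded_algebra G C)
    (subC : forall g, C g `<=` C' (phi g))
    (x : A) (x_hom : homogeneous C' x)
    (n : nat) (a : nat -> {fraction A})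
    (rel : homogeneous_integral_relation G C C' (tofrac x) n a)
    (min : forall p : {poly {fraction A}},
       p \is a polyOver [in saturation G C] -> p != 0 -> (size p <= n)%N ->
       p.[tofrac x] != 0) :
  forall y : {fraction A},
    saturation (adjoin C' G x) (induced_comp (adjoin C' G x) C') y ->
    exists! p : {poly {fraction A}},
      [/\ p \is a polyOver [in saturation G C], (size p <= n)%N
        & y = p.[tofrac x]].
Proof.
(* Since [phi] and translations reflect the orders, antisymmetry makes them injective. *)
have phi_inj : injective phi.
  move=> g h e; apply: (osg_anti ordGam).
  by rewrite -!phi_le e (osg_refl ordGam').
have addI' (z : Gam') : injective (+%R^~ z).
  move=> g h /= e; apply: (osg_anti ordGam').
  by rewrite -(osg_leD2r ordGam' z g h) -(osg_leD2r ordGam' z h g) /= e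
    (osg_refl ordGam').
have [f [sf fx Cf hf]] := relation_polynomial addI' gradA gradG subC x_hom rel.
pose Ks : subringClosed {fraction A} := subring_pred (saturation_subring gradG).
have minA (p : {poly A}) : p \is a polyOver (subring_pred (graded_subring gradG)) ->
    p != 0 -> (size p <= n)%N -> p.[x] != 0.
  move=> /map_tofrac_over pK p0 spn.
  have sp : size (map_poly (@tofrac A) p) = size p.
    by rewrite size_map_poly_id0 // tofrac_eq0 lead_coef_eq0.
  rewrite -tofrac_eq0 -horner_map; apply: min => //; last by rewrite sp.
  by rewrite -size_poly_gt0 sp size_poly_gt0.
move=> y [u [h [/(adjoin_horner phi_inj addI' gradA gradG subC x_hom) [p pG ->] _]]].
move=> /(homogeneous_adjoin phi_inj addI' gradA gradG subC x_hom) [p' hp' ->] h0 ->.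
have [q [c [qG Cc c0 qc]]] := homogeneous_inverse phi_inj addI' gradA subC
  sf fx hf minA hp' h0.
have f0 : f != 0 by rewrite -size_poly_gt0 sf.
have sft : size (map_poly (@tofrac A) f) = n.+1.
  by rewrite size_map_poly_id0 // tofrac_eq0 lead_coef_eq0.
(* As [q.[x] * p'.[x] = c], the fraction [p.[x] / p'.[x]] equals [(p * q).[x] / c], a value of a
   polynomial over the saturation, still to be reduced modulo [f]. *)
pose w := (tofrac c)^-1 *: map_poly (@tofrac A) (p * q).
have [G1 _ _] := graded_subringP gradG.
have invK d : homogeneous C d -> d != 0 -> (tofrac d)^-1 \in Ks.
  by move=> Cd d0; rewrite in_setE -div1r -tofrac1; apply: saturation_div.
have [|||||r [rK sr rE]] :=
  @horner_reduce _ Ks (map_poly (@tofrac A) f) w (tofrac x).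
- by rewrite -size_poly_gt0 sft.
- apply: map_tofrac_over; apply/polyOverP => i; rewrite in_setE.
  exact: (homogeneous_sub gradG).
- rewrite lead_coef_map_id0 ?tofrac_eq0 ?lead_coef_eq0 //.
  by apply: invK; rewrite ?lead_coef_eq0 // lead_coefE.
- by apply/rootP; rewrite horner_map fx.
- by rewrite polyOverZ ?invK // map_tofrac_over // rpredM.
have yr : tofrac p.[x] / tofrac p'.[x] = r.[tofrac x].
  rewrite rE hornerZ horner_map hornerM -qc /= !tofracM.
  have q0 : q.[x] != 0 by apply: contraNneq c0 => q0; rewrite -qc q0 mul0r.
  rewrite [RHS]mulrC [tofrac q.[x] * _]mulrC -mulf_div divff ?mulr1 //.
  by rewrite tofrac_eq0.
have srn : (size r <= n)%N by rewrite -ltnS -sft.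
exists r; split=> // r' [rK' sr' yr'].
(* Two distinct representations would differ by a nonzero polynomial of size at most [n] vanishing
   at [x], against [min]. *)
apply/eqP; rewrite -subr_eq0; apply: contraT => rr'.
have: (r - r').[tofrac x] != 0.
  apply: min => //; first exact: rpredB rK (rK' : r' \is a polyOver Ks).
  by rewrite (leq_trans (size_polyD _ _)) // size_polyN geq_max srn.
by rewrite hornerD hornerN -yr' yr subrr eqxx.
Qed.
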